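(* Let $(X,T)$ be a topological space. Then the topological space $({}^{*}X,{}^{S}T)$ is a locally compact, supercompact enlargement of $(X,T)$.
   Context: Nonstandard setting: fix a nonstandard extension map $*$ on a superstructure containing all the sets under consideration, satisfying the transfer principle, with each $x\in X$ identified with ${}^{*}x$, so that $X\subseteq {}^{*}X$ and ${}^{*}A\cap X=A$ for all $A\subseteq X$. The extension is assumed to be an enlargement, saturated in the following sense: for every set $X$ under consideration and every family $\{F_i\}_{i\in I}$ of subsets of $X$ with the finite intersection property, there is $\alpha\in{}^{*}X$ with $\alpha\in{}^{*}F_i$ for all $i\in I$. For a topological space $(X,T)$, ${}^{S}T$ denotes the (standard) topology on ${}^{*}X$ with base $\{{}^{*}G : G\in T\}$; the space $(X,T)$ is embedded in $({}^{*}X,{}^{S}T)$ by the inclusion. No separation axioms are assumed in the following definitions. A topological space $(Y,\tau)$ is locally compact if for every $y\in Y$ and every open $V\in\tau$ containing $y$ there is a compact neighbourhood $W$ of $y$ (not necessarily open) with $W\subseteq V$. A topological space $(Y,\tau)$ is supercompact if for every ultrafilter $\mathcal{U}$ on the set $Y$ there is an essentially unique point $y\in Y$ such that the set of cluster points $\mathrm{adh}\,\mathcal{U}=\bigcap\{\mathrm{cl}_\tau H : H\in\mathcal{U}\}$ equals $\mathrm{cl}_\tau\{y\}$. Essentially unique means that if $y'$ is any other point with the same property, then $y$ and $y'$ have exactly the same $\tau$-neighbourhoods. *)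

(* Defs.v *)
From HB Require Import structures.
From mathcomp Require Import all_boot all_order.
From mathcomp Require Import boolp classical_sets functions filter topology.

Set Implicit Arguments.
Unset Strict Implicit.
Unset Printing Implicit Defensive.

Local Open Scope classical_set_scope.

(* V_0 = S and V_{n+1} = V_n \cup P(V_n), for a universe V with individuals
   [ind : S -> V] and membership [smem x a] ("x is an element of a"); the
   elements of V that are not individuals are the sets. *)
Fixpoint ss_level (S V : Type) (ind : S -> V) (smem : V -> V -> Prop) (n : nat)
    : set V :=
  match n with
  | 0 => range ind
  | m.+1 => ss_level ind smem m `|`
      [set a | ~ range ind a /\ [set x | smem x a] `<=` ss_level ind smem m]
  end.

(* The superstructure V(S), the union of the V_n(S), over a set S of
   individuals. The fields determine it up to a unique isomorphism fixing S. *)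
Record superstructure (S : Type) := Superstructure {
  ss_sort :> Type;
  ss_atom : S -> ss_sort;
  smem : ss_sort -> ss_sort -> Prop;
  ss_atom_inj : injective ss_atom;
  smem_atom : forall x s, ~ smem x (ss_atom s);
  ss_ext : forall a b, ~ range ss_atom a -> ~ range ss_atom b ->
    (forall x, smem x a <-> smem x b) -> a = b;
  ss_rank : forall a, exists n, ss_level ss_atom smem n a;
  ss_full : forall n (A : set ss_sort), A `<=` ss_level ss_atom smem n ->
    exists2 a, ~ range ss_atom a & forall x, smem x a <-> A x
}.

Definition is_set (S : Type) (V : superstructure S) : set V :=
  ~` range (@ss_atom S V).

(* Bounded formulas of the language of set theory, with variables in nat;
   [BAll x y p] is "for all x in y, p". The remaining connectives and the
   bounded existential quantifier are the usual classical abbreviations. *)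
Inductive bformula :=
  | BEq of nat & nat
  | BIn of nat & nat
  | BNot of bformula
  | BAnd of bformula & bformula
  | BAll of nat & nat & bformula.

Fixpoint holds (S : Type) (V : superstructure S) (e : nat -> V) (p : bformula)
    : Prop :=
  match p with
  | BEq x y => e x = e y
  | BIn x y => smem (e x) (e y)
  | BNot q => ~ holds e q
  | BAnd q r => holds e q /\ holds e r
  | BAll x y q => forall v : V, smem v (e y) -> holds [eta e with x |-> v] q
  end.

(* A nonstandard extension map V(S) -> V(S'), where S' is the value of S. The
   parameters of a transferred formula are given by the valuation. *)
Record nsext (S S' : Type) (V : superstructure S) (W : superstructure S') :=
  NSExt {
  star :> V -> W;
  star_individuals : forall a : V, is_set a ->
    (forall x, smem x a <-> range (@ss_atom S V) x) ->
    forall y, smem y (star a) <-> range (@ss_atom S' W) y;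
  transfer : forall (p : bformula) (e : nat -> V),
    holds e p <-> holds (star \o e) p
}.

(* A realization of the type X as a set [code_set] of the superstructure. *)
Record coding (S : Type) (V : superstructure S) (X : Type) := Coding {
  code_set : V;
  code :> X -> V;
  code_inj : injective code;
  code_is_set : is_set code_set;
  code_mem : forall v, smem v code_set <-> range code v
}.

Lemma ss_subset_ex (S : Type) (V : superstructure S) (X : Type)
    (c : coding V X) (A : set X) :
  exists a : V, is_set a /\ forall v, smem v a <-> (c @` A) v.
Proof.
suff [m cm] : exists m, [set x | smem x (code_set c)]
    `<=` ss_level (@ss_atom S V) (@smem S V) m.
  have [|a a_set aP] := @ss_full S V m (c @` A); last by exists a.
  by move=> _ [x _ <-]; apply/cm/code_mem; exists x.
have [n] := ss_rank (code_set c); elim: n => [/(code_is_set (c := c))//|n IHn].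
by case=> [|[_ ?]]; [exact: IHn|exists n].
Qed.

Definition ss_subset (S : Type) (V : superstructure S) (X : Type)
  (c : coding V X) (A : set X) : V := projT1 (cid (ss_subset_ex c A)).

Lemma ss_subset_is_set (S : Type) (V : superstructure S) (X : Type)
    (c : coding V X) (A : set X) : is_set (ss_subset c A).
Proof. by rewrite /ss_subset; case: cid => a []. Qed.

Lemma smem_subset (S : Type) (V : superstructure S) (X : Type)
    (c : coding V X) (A : set X) v :
  smem v (ss_subset c A) <-> (c @` A) v.
Proof. by rewrite /ss_subset; case: cid => a []. Qed.

Lemma ss_subsetT (S : Type) (V : superstructure S) (X : Type)
    (c : coding V X) : ss_subset c setT = code_set c.
Proof.
apply: ss_ext; [exact: ss_subset_is_set|exact: code_is_set|] => v.
by rewrite smem_subset code_mem.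
Qed.

(* The set *X, as a type. *)
Definition star_type (S S' : Type) (V : superstructure S)
    (W : superstructure S') (st : nsext V W) (X : Type) (c : coding V X) : Type :=
  {a : W | smem a (st (code_set c))}.

(* *A as a subset of *X, for a subset A of X. *)
Definition star_set (S S' : Type) (V : superstructure S)
    (W : superstructure S') (st : nsext V W) (X : Type) (c : coding V X)
    (A : set X) : set (star_type st c) :=
  [set a | smem (proj1_sig a) (st (ss_subset c A))].

Arguments star_set {S S' V W} st {X} c A.

Lemma smem_star (S S' : Type) (V : superstructure S) (W : superstructure S')
    (st : nsext V W) (a b : V) : smem a b <-> smem (st a) (st b).
Proof. exact: (transfer st (BIn 0 1) (nth b [:: a; b])). Qed.

Lemma star_code_mem (S S' : Type) (V : superstructure S)
    (W : superstructure S') (st : nsext V W) (X : Type) (c : coding V X) (x : X) :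
  smem (st (c x)) (st (code_set c)).
Proof. by rewrite -smem_star code_mem; exists x. Qed.

(* The inclusion of X in *X, which identifies x with *x. *)
Definition star_incl (S S' : Type) (V : superstructure S)
    (W : superstructure S') (st : nsext V W) (X : Type) (c : coding V X) (x : X)
    : star_type st c := exist _ (st (c x)) (star_code_mem st c x).

Definition enlargement (S S' : Type) (V : superstructure S)
    (W : superstructure S') (st : nsext V W) : Prop :=
  forall (X : Type) (c : coding V X) (I : choiceType) (F : I -> set X),
    finI setT F -> exists a : star_type st c, forall i, star_set st c (F i) a.

Lemma star_setT (S S' : Type) (V : superstructure S) (W : superstructure S')
    (st : nsext V W) (X : Type) (c : coding V X) :
  star_set st c setT = setT.
Proof. by apply/seteqP; split=> // -[a aX] _; rewrite /star_set/= ss_subsetT. Qed.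

Lemma star_setI (S S' : Type) (V : superstructure S) (W : superstructure S')
    (st : nsext V W) (X : Type) (c : coding V X) (A B : set X) :
  star_set st c (A `&` B) =
  star_set st c A `&` star_set st c B.
Proof.
set a := ss_subset c A; set b := ss_subset c B.
set d := ss_subset c (A `&` B).
pose e := nth a [:: a; b; d].
have dab : holds e (BAll 3 2 (BAnd (BIn 3 0) (BIn 3 1))).
  move=> v; rewrite /= !smem_subset => -[x [Ax Bx] xv].
  by split; exists x.
have abd : holds e (BAll 3 0 (BNot (BAnd (BIn 3 1) (BNot (BIn 3 2))))).
  move=> v; rewrite /= !smem_subset => -[x Ax <-] [[y By yx]]; apply.
  by exists x => //; split=> //; rewrite -(code_inj yx).
move/(transfer st): dab => /= dab; move/(transfer st): abd => /= abd.
apply/seteqP; split=> -[z zX]; rewrite /star_set/=.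
  by move=> /dab.
by move=> [za zb]; apply: contrapT => zd; exact: (abd z za).
Qed.

HB.instance Definition _ (S S' : Type) (V : superstructure S)
  (W : superstructure S') (st : nsext V W) (X : Type) (c : coding V X) :=
  gen_eqMixin (star_type st c).
HB.instance Definition _ (S S' : Type) (V : superstructure S)
  (W : superstructure S') (st : nsext V W) (X : Type) (c : coding V X) :=
  gen_choiceMixin (star_type st c).

Lemma star_base_cover (S S' : Type) (V : superstructure S)
    (W : superstructure S') (st : nsext V W) (X : topologicalType)
    (c : coding V X) :
  \bigcup_(G in [set G : set X | open G]) star_set st c G = setT.
Proof.
apply/seteqP; split=> // a _.
by exists setT; [exact: openT|rewrite star_setT].
Qed.

Lemma star_base_join (S S' : Type) (V : superstructure S)
    (W : superstructure S') (st : nsext V W) (X : topologicalType)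
    (c : coding V X) (G H : set X) (t : star_type st c) :
  [set G : set X | open G] G -> [set G : set X | open G] H ->
  star_set st c G t -> star_set st c H t ->
  exists k : set X, [/\ [set G : set X | open G] k, star_set st c k t &
    star_set st c k `<=` star_set st c G `&` star_set st c H].
Proof.
move=> oG oH Gt Ht; exists (G `&` H); split; first exact: openI.
  by rewrite star_setI.
by rewrite star_setI.
Qed.

(* The standard topology on *X, with base the *G for G open in X. *)
HB.instance Definition _ (S S' : Type) (V : superstructure S)
  (W : superstructure S') (st : nsext V W) (X : topologicalType)
  (c : coding V X) :=
  isBaseTopological.Build (star_type st c)
    (@star_base_cover S S' V W st X c) (@star_base_join S S' V W st X c).

(* Neither the library's [locally_compact] (each point has one precompact
   neighbourhood) nor any separation axiom is meant here. *)
Definition locally_compact_space (Y : topologicalType) : Prop :=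
  forall (y : Y) (V : set Y), open V -> V y ->
    exists W : set Y, [/\ nbhs y W, compact W & W `<=` V].

Definition adherence (Y : topologicalType) (U : set_system Y) : set Y :=
  \bigcap_(H in U) closure H.

Definition supercompact (Y : topologicalType) : Prop :=
  forall U : set_system Y, UltraFilter U ->
    exists y : Y, adherence U = closure [set y] /\
      forall y' : Y, adherence U = closure [set y'] -> nbhs y' = nbhs y.

Definition embedding (X Y : topologicalType) (f : X -> Y) : Prop :=
  injective f /\
  forall A : set X, open A <-> exists2 B : set Y, open B & A = f @^-1` B.

(* Main.v *)
Require Import Defs.
From mathcomp Require Import all_boot all_order.
From mathcomp Require Import boolp classical_sets functions filter topology.

(** The map sending a subset [A] of [X] to [*A] is a homomorphism of Boolean
    algebras ([star_setI], [star_setC]). Hence a proper filter on [*X]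
    pulls back along it to a proper filter on [X], the trace of the original
    filter, and saturation produces a point [a] of [*X] that lies in every [*B]
    with [B] in the trace ([star_trace_point]). Everything rests on this point.

    It is a cluster point of the filter: the complement of a basic open set [*G]
    is [*(~` G)], so if [*G] were disjoint from a member of the filter then
    [~` G] would belong to the trace, and [a] would lie in [*(~` G)]. As [a] also
    lies in [*A] as soon as [*A] belongs to the filter, every [*A], open or not,
    is compact; the basic open sets are therefore compact, whence local
    compactness.

    When the filter is an ultrafilter [U], exactly one of [*G] and [*(~` G)]
    belongs to it, so that [a] lies in [*G] if and only if [*G] belongs to [U].
    A point [b] is adherent to [U] when every [*G] containing [b] belongs to [U],
    that is, when every basic neighbourhood of [b] contains [a], which says that
    [b] is in the closure of [a]. Two points with the same closure lie in the
    same open sets, hence the essential uniqueness.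

    The embedding claim holds because [*A] meets [X] exactly in [A]. *)

Set Implicit Arguments.
Unset Strict Implicit.
Unset Printing Implicit Defensive.

Local Open Scope classical_set_scope.

(** Each point is adherent to the other, so every open set around one contains
    the other. Without a separation axiom the points may still differ. *)
Lemma closure1_nbhs (Y : topologicalType) (y z : Y) :
  closure [set y] = closure [set z] -> nbhs y = nbhs z.
Proof.
suff sub (u v : Y) : closure [set u] = closure [set v] -> nbhs u `<=` nbhs v.
  by move=> yz; apply/seteqP; split; exact: sub.
move=> uv N; rewrite nbhsE => -[O [oO Ou] ON].
have clu : closure [set v] u by rewrite -uv; exact: subset_closure.
have [_ [-> Ov]] := clu O (open_nbhs_nbhs (conj oO Ou)).
by apply: filterS ON _; exact: open_nbhs_nbhs.
Qed.

Section StarSets.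
Context (S S' : Type) (V : superstructure S) (W : superstructure S').
Context (st : nsext V W).

Lemma star_inj : injective st.
Proof.
by move=> a b; exact: (transfer st (BEq 0 1) (nth b [:: a; b])).2.
Qed.

Section AnySet.
Context (X : Type) (c : coding V X).
Implicit Types A B : set X.

(** Transfer of the two bounded sentences that characterize a complement in the
    set [X]: no element of [A] is in [B], and each element of [X] is in one of
    them. *)
Lemma star_setC A : star_set st c (~` A) = ~` star_set st c A.
Proof.
set a := ss_subset c A; set b := ss_subset c (~` A).
pose e := nth a [:: a; b; code_set c].
have dis : holds e (BAll 3 0 (BNot (BIn 3 1))).
  move=> v; rewrite /= !smem_subset => -[x Ax <-] [y nAy yx]; apply: nAy.
  by rewrite (code_inj yx).
have cov : holds e (BAll 3 2 (BNot (BAnd (BNot (BIn 3 0)) (BNot (BIn 3 1))))).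
  move=> v; rewrite /= !smem_subset code_mem => -[x _ <-] [nA nC].
  by apply: nC; exists x => // Ax; apply: nA; exists x.
move/(transfer st): dis => /= dis; move/(transfer st): cov => /= cov.
apply/seteqP; split=> -[z zX]; rewrite /star_set/=.
  by move=> zC zA; exact: (dis z zA).
by move=> nzA; apply: contrapT => nzC; exact: (cov z zX).
Qed.

Lemma star_set0 : star_set st c set0 = set0.
Proof. by rewrite -setCT star_setC star_setT setCT. Qed.

Lemma star_setS A B : A `<=` B -> star_set st c A `<=` star_set st c B.
Proof. by move=> /setIidPl <-; rewrite star_setI => a []. Qed.

Lemma star_incl_preimage A : star_incl st c @^-1` star_set st c A = A.
Proof.
apply/seteqP; split=> x; rewrite /star_set/= -smem_star smem_subset.
  by move=> [y Ay yx]; rewrite -(code_inj yx).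
by move=> Ax; exists x.
Qed.

Lemma star_incl_inj : injective (star_incl st c).
Proof. by move=> x y /(congr1 (@proj1_sig _ _))/star_inj xy; exact: (code_inj xy). Qed.

Definition star_trace (F : set_system (star_type st c)) : set_system X :=
  [set B | F (star_set st c B)].

Lemma star_trace_filter (F : set_system (star_type st c)) :
  ProperFilter F -> ProperFilter (star_trace F).
Proof.
move=> FF; split; first by rewrite /star_trace/= star_set0; exact: filter_not_empty.
split.
- by rewrite /star_trace/= star_setT; exact: filterT.
- by move=> A B FA FB; rewrite /star_trace/= star_setI; exact: filterI.
- by move=> A B /star_setS; exact: filterS.
Qed.

(** A proper filter on [X] has the finite intersection property, so saturation
    applies to the trace. *)
Lemma star_trace_point (F : set_system (star_type st c)) :
  enlargement st -> ProperFilter F ->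
  exists a, forall B, F (star_set st c B) -> star_set st c B a.
Proof.
move=> st_enl FF; have trF := star_trace_filter FF.
(* The index set is that of all subsets of [X]; those outside the trace are
   replaced with [X]. *)
pose f (B : {classic (set X)}) : set X := [set x | star_trace F B -> B x].
have trf B : star_trace F (f B).
  have [FB|nFB] := pselect (star_trace F B); first by apply: filterS FB => x Bx _.
  by apply: filterS filterT => x _ /nFB.
have [D _|a aP] := st_enl X c {classic (set X)} f.
  by apply: (@filter_ex _ (star_trace F)); exact: filter_bigI.
exists a => B FB; apply: star_setS (aP B) => x; exact.
Qed.

End AnySet.

Section StandardTopology.
Context (X : topologicalType) (c : coding V X).

Lemma star_open (G : set X) : open G -> open (star_set st c G).
Proof.
move=> oG; exists [set G]; first by move=> _ ->.
by rewrite bigcup_set1.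
Qed.

Lemma star_nbhsP (a : star_type st c) (N : set (star_type st c)) :
  nbhs a N <->
  exists G : set X, [/\ open G, star_set st c G a & star_set st c G `<=` N].
Proof.
split=> [|[G [oG Ga GN]]].
  rewrite nbhsE => -[_ [[D Do <-] [G DG Ga]] BN].
  by exists G; split=> //; [exact: Do|move=> b Gb; apply: BN; exists G].
by apply: filterS GN _; apply: open_nbhs_nbhs; split=> //; exact: star_open.
Qed.

(** Basic open neighbourhoods suffice to test clustering, and their complements
    are again of the form [*B]. *)
Lemma star_trace_cluster (F : set_system (star_type st c)) a : Filter F ->
  (forall B, F (star_set st c B) -> star_set st c B a) -> cluster F a.
Proof.
move=> FF aP H N FH /star_nbhsP [G [_ Ga GN]].
apply: contrapT => HN0; suff : star_set st c (~` G) a by rewrite star_setC.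
apply: aP; rewrite star_setC; apply: filterS FH => b Hb Gb; apply: HN0.
by exists b; split=> //; exact: GN.
Qed.

Lemma star_compact (A : set X) : enlargement st -> compact (star_set st c A).
Proof.
move=> st_enl F FF FA; have [a aP] := star_trace_point st_enl FF.
by exists a; split; [exact: aP|exact: star_trace_cluster].
Qed.

Lemma star_locally_compact :
  enlargement st -> locally_compact_space (star_type st c).
Proof.
move=> st_enl a O oO Oa.
have /star_nbhsP[G [oG Ga GO]] : nbhs a O by apply: open_nbhs_nbhs.
exists (star_set st c G); split=> //; last exact: star_compact.
by apply: open_nbhs_nbhs; split=> //; exact: star_open.
Qed.

Lemma star_supercompact : enlargement st -> supercompact (star_type st c).
Proof.
move=> st_enl U UU; have [a aP] := star_trace_point st_enl ultra_proper.
(* Adherent points are in the closure of [a] because [U], being an ultrafilter,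
   contains [*G] or its complement; conversely [a] is a cluster point of [U],
   and the adherence of [U] is closed. *)
have adhU : adherence U = closure [set a].
  rewrite /adherence -clusterE; apply/seteqP; split=> b.
    move=> Ub N /star_nbhsP[G [oG Gb GN]]; exists a; split=> //; apply: GN.
    apply: contrapT => nGa.
    have [UG|UnG] := in_ultra_setVsetC (star_set st c G) UU; first exact/nGa/aP.
    have bG : nbhs b (star_set st c G).
      by apply: open_nbhs_nbhs; split=> //; exact: star_open.
    by have [d []] := Ub _ _ UnG bG.
  rewrite clusterE => ab H UH.
  rewrite ((closure_id (closure H)).1 (@closed_closure _ H)).
  have aH : closure H a.
    by have := star_trace_cluster _ aP; rewrite clusterE; apply.
  by apply: closure_subset ab => _ ->.
by exists a; split=> // b; rewrite adhU => /closure1_nbhs.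
Qed.

Lemma star_embedding : embedding (star_incl st c).
Proof.
split=> [|A]; first exact: star_incl_inj.
split=> [oA|[_ [D Do <-] ->]].
  by exists (star_set st c A); [exact: star_open|rewrite star_incl_preimage].
rewrite preimage_bigcup; apply: bigcup_open => G DG.
by rewrite star_incl_preimage; exact: Do.
Qed.

End StandardTopology.
End StarSets.

Theorem theorem2p7 (S S' : Type) (V : superstructure S) (W : superstructure S')
    (st : nsext V W) (st_enl : enlargement st)
    (X : topologicalType) (c : coding V X) :
  [/\ locally_compact_space (star_type st c),
      supercompact (star_type st c) &
      embedding (star_incl st c)].
Proof.
split; [exact: star_locally_compact|exact: star_supercompact|].
exact: star_embedding.
Qed.
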